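(* Let $T>0$ and $H\in(1/2,1)$. Let $\gamma(t)=-2H(2H-1)t^{2H-2}$ for $t\in(0,T]$, and for $k\ge1$ let $$c_k:=\frac{2}{T}\int_0^T\gamma(t)\cos\frac{k\pi t}{T}\,\mathrm{d}t .$$ Let $(Z_k)_{k\in\mathbb{Z}}$ be a sequence of independent standard Gaussian random variables, and let $B=(B_t)_{t\in[0,T]}$ be the stochastic process given by the series expansion $$B_t=\sqrt{HT^{2H-2}}\,t\,Z_0+\sum_{k=1}^{\infty}\frac{T}{k\pi}\sqrt{-\frac{c_k}{2}}\left(Z_k\sin\frac{k\pi t}{T}+Z_{-k}\left(1-\cos\frac{k\pi t}{T}\right)\right),\qquad t\in[0,T],$$ where the series is assumed to converge in mean square for every $t\in[0,T]$. Then $$\forall (s,t)\in[0,T]^2,\qquad \mathbf{E}(B_sB_t)=\frac12\left(t^{2H}+s^{2H}-|t-s|^{2H}\right).$$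
   Context: The coefficients satisfy $c_k\le 0$ for all $k\ge 1$, so the square roots are real nonnegative numbers. *)

(* Defs.v *)
From HB Require Import structures.
From mathcomp Require Import all_boot all_order all_algebra.
From mathcomp Require Import all_classical all_reals all_analysis.
Set Implicit Arguments.
Unset Strict Implicit.
Unset Printing Implicit Defensive.
Import Order.TTheory GRing.Theory Num.Theory.
Import numFieldNormedType.Exports.
Local Open Scope classical_set_scope.
Local Open Scope ring_scope.

Definition mutually_independent (d : measure_display) (Omega : measurableType d)
    (R : realType) (P : probability Omega R) (I : eqType)
    (X : I -> {RV P >-> R}) : Prop :=
  forall (s : seq I) (A : I -> set R),
    uniq s -> (forall i, measurable (A i)) ->
    P (\bigcap_(i in [set` s]) (X i @^-1` A i)) =
      (\prod_(i <- s) P (X i @^-1` A i))%E.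

(* The laws are only compared on measurable sets: [normal_prob] has no meaning
   elsewhere. *)
Definition standard_gaussian (d : measure_display) (Omega : measurableType d)
    (R : realType) (P : probability Omega R) (X : {RV P >-> R}) : Prop :=
  forall A : set R, measurable A -> distribution P X A = normal_prob 0 1 A.

(* The expectation is extended-real valued, so the convergence to 0 forces
   [Y - X n] to be square integrable for all large [n]. *)
Definition cvg_mean_square (d : measure_display) (Omega : measurableType d)
    (R : realType) (P : probability Omega R)
    (X : nat -> Omega -> R) (Y : Omega -> R) : Prop :=
  ('E_P[(fun w => (Y w - X n w) ^+ 2)%R] @[n --> \oo] --> 0)%E.

Definition gamma_fun (R : realType) (H t : R) : R :=
  - (2 * H * (2 * H - 1)) * t `^ (2 * H - 2).

Definition cos_coef (R : realType) (T H : R) (k : nat) : R :=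
  2 / T * \int[lebesgue_measure]_(t in `]0, T])
            (gamma_fun H t * cos (k%:R * pi * t / T)).

(* [Num.sqrt] is 0 on negative numbers; as [cos_coef T H k <= 0] for
   [1 <= k] (and [1/2 < H < 1]), this junk value never occurs. *)
Definition series_term (R : realType) (Omega : Type) (T H : R)
    (Z : int -> Omega -> R) (t : R) (k : nat) (w : Omega) : R :=
  T / (k%:R * pi) * Num.sqrt (- (cos_coef T H k / 2)) *
  (Z k%:Z w * sin (k%:R * pi * t / T) +
   Z (- k%:Z) w * (1 - cos (k%:R * pi * t / T))).

Definition series_partial_sum (R : realType) (Omega : Type) (T H : R)
    (Z : int -> Omega -> R) (t : R) (n : nat) (w : Omega) : R :=
  Num.sqrt (H * T `^ (2 * H - 2)) * t * Z 0 w +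
  \sum_(1 <= k < n.+1) series_term T H Z t k w.

(* Main.v *)
Require Import Defs.
From HB Require Import structures.
From mathcomp Require Import all_boot all_order all_algebra.
From mathcomp Require Import all_classical all_reals all_analysis.
From mathcomp Require Import measurable_realfun ring lra.
Import Order.TTheory GRing.Theory Num.Theory.
Import numFieldNormedType.Exports.
Local Open Scope classical_set_scope.
Local Open Scope ring_scope.

Set Implicit Arguments.
Unset Strict Implicit.

(** The Gaussian variables are orthonormal in L2, so the covariance of the
    partial sums S_n is explicit. With
      F_n(u) = sum_(k <= n) (T / (k pi))^2 (- c_k / 2) (1 - cos (k pi u / T)),
    the addition formulas give
      E(S_n(s) S_n(t)) = H T^(2H-2) s t + F_n(s) + F_n(t) - F_n(|t - s|)
    ([inner_series_partial_sum]). Mean square convergence carries inner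
    products to the limit ([cvg_inner]), so everything rests on
      F_n(u) --> phi(u) := (u^(2H) - H T^(2H-2) u^2) / 2   for 0 <= u <= T
    ([cvg_variance_series]). The identity s^2 + t^2 - (t - s)^2 = 2 s t then
    cancels the quadratic parts of phi against the term H T^(2H-2) s t.

    Since gamma = - 2 phi'' - 2H T^(2H-2), this limit says that phi, extended
    to an even 2T-periodic function, is the sum of its cosine series. It has a
    direct proof: insert the integral that defines c_k and exchange sum and
    integral. The kernel that appears is
      sum_k cos (k pi t / T) (1 - cos (k pi u / T)) / k^2,
    which the product formula for cosines reduces to values of the single
    series sum_k (1 - cos (k x)) / k^2 = pi x / 2 - x^2 / 4 on [0, 2 pi]
    ([cvg_cos_sqr_sum]). The quadratic polynomials collapse to
    pi^2 / (2T) (u - t)^+ minus a constant, and the integral of this against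
    t^(2H-2) is elementary. The partial kernels are uniformly bounded and gamma
    is integrable, so dominated convergence applies.

    Two further points carry weight. The square of the square root in the
    coefficients gives back - c_k / 2 only if c_k <= 0 ([cos_coef_le0]): this
    holds because t^(2H-2) is decreasing and convex
    ([cosine_transform_powR_ge0]). And the orthonormality
    of the family ([gaussian_orthonormal]) comes from the product of laws and
    from the first two moments of the normal density. *)

(** * Differentiation of explicit functions *)

Section pointwise_derivatives.
Context {R : realType}.
Implicit Types (f g : R -> R) (x a b c : R).

(** This rule and the following ones are stated with explicit abstractions, so
    that they unify with a function given by a formula. *)
Lemma is_derive1D f g x a b : is_derive x 1 f a -> is_derive x 1 g b ->
  is_derive x 1 (fun y => f y + g y) (a + b).
Proof. by move=> df dg; apply: (@is_deriveD _ _ _ f g). Qed.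

Lemma is_derive1B f g x a b : is_derive x 1 f a -> is_derive x 1 g b ->
  is_derive x 1 (fun y => f y - g y) (a - b).
Proof. by move=> df dg; apply: (@is_deriveB _ _ _ f g). Qed.

Lemma is_derive1M f g x a b : is_derive x 1 f a -> is_derive x 1 g b ->
  is_derive x 1 (fun y => f y * g y) (f x * b + g x * a).
Proof. by move=> df dg; apply: (@is_deriveM _ _ f g). Qed.

Lemma is_derive1Z f x c a : is_derive x 1 f a ->
  is_derive x 1 (fun y => c * f y) (c * a).
Proof. by move=> df; apply: (@is_deriveZ _ _ _ f c). Qed.

Lemma is_derive1V f x a : f x != 0 -> is_derive x 1 f a ->
  is_derive x 1 (fun y => (f y)^-1) (- (f x) ^- 2 * a).
Proof. by move=> fx df; apply: (@is_deriveV _ f). Qed.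

Lemma is_derive1_sum n (h : nat -> R -> R) (dh : nat -> R) x :
  (forall k, is_derive x 1 (h k) (dh k)) ->
  is_derive x 1 (fun y => \sum_(1 <= k < n.+1) h k y)
    (\sum_(1 <= k < n.+1) dh k).
Proof.
move=> hd; elim: n => [|n IH].
  under eq_fun do rewrite big_geq//.
  by rewrite big_geq//; exact: is_derive_cst.
under eq_fun do rewrite big_nat_recr//=.
by rewrite big_nat_recr//=; exact: is_derive1D.
Qed.

Lemma is_derive1_lin c x : is_derive x 1 (fun y => c * y) c.
Proof. by rewrite -[X in is_derive _ _ _ X]mulr1; apply: is_derive1Z. Qed.

Lemma is_derive1_sinM c x :
  is_derive x 1 (fun y => sin (c * y)) (cos (c * x) * c).
Proof. exact: (@is_derive1_comp _ sin _ _ _ _ _ (is_derive1_lin c x)). Qed.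

Lemma is_derive1_cosM c x :
  is_derive x 1 (fun y => cos (c * y)) (- sin (c * x) * c).
Proof. exact: (@is_derive1_comp _ cos _ _ _ _ _ (is_derive1_lin c x)). Qed.

Lemma is_derive1_continuous f x a : is_derive x 1 f a -> {for x, continuous f}.
Proof. by move=> [+ _] => /derivable1_diffP/differentiable_continuous. Qed.

Lemma is_derive1_within_continuous f (A : set R) (df : R -> R) :
  (forall x, A x -> is_derive x 1 f (df x)) -> {within A, continuous f}.
Proof.
move=> fd; apply: continuous_in_subspaceT => x /[!inE] /fd.
exact: is_derive1_continuous.
Qed.

Lemma lipschitz_of_derive1 f (df : R -> R) a b M :
  (forall x, a <= x <= b -> is_derive x 1 f (df x)) ->
  (forall x, a <= x <= b -> `|df x| <= M) ->
  forall x y, a <= x <= b -> a <= y <= b -> `|f x - f y| <= M * `|x - y|.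
Proof.
move=> fd dM x y; wlog xy : x y / y <= x.
  move=> H xab yab; have [|/ltW] := leP y x => xy; first exact: H.
  by rewrite distrC [`|x - y|]distrC; exact: H.
move=> /andP[ax xb] /andP[ay yb].
have inab z : z \in `[y, x]%R -> a <= z <= b.
  by rewrite in_itv/= => /andP[yz zx]; rewrite (le_trans ay)//= (le_trans zx).
have [||c cyx ->] := @MVT_segment R f df y x xy.
- by move=> z zyx; apply/fd/inab; exact: subset_itv_oo_cc zyx.
- by apply: (@is_derive1_within_continuous _ _ df) => z /= /inab; exact: fd.
by rewrite normrM ler_wpM2r//; exact/dM/inab.
Qed.

End pointwise_derivatives.

(** * The series of (1 - cos (k x)) / k^2 *)

Section cosine_series.
Context {R : realType}.
Implicit Types (x y : R) (n m : nat).

Definition cos_sqr_sum n x : R :=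
  \sum_(1 <= k < n.+1) (1 - cos (k%:R * x)) / k%:R ^+ 2.

(** The derivative of the remainder [cos_sqr_sum n x - (pi x / 2 - x ^+ 2 / 4)]. *)
Let err n x := \sum_(1 <= k < n.+1) sin (k%:R * x) / k%:R - (pi - x) / 2.

Lemma dirichlet_kernel n x :
  sin (x / 2) * (2^-1 + \sum_(1 <= k < n.+1) cos (k%:R * x)) =
  sin ((n%:R + 2^-1) * x) / 2.
Proof.
elim: n => [|n IH].
  by rewrite big_geq// addr0 add0r [x / 2]mulrC.
rewrite big_nat_recr//= addrA mulrDr IH.
have -> : (n.+1%:R + 2^-1) * x = n.+1%:R * x + x / 2 by ring.
have -> : (n%:R + 2^-1) * x = n.+1%:R * x - x / 2 by rewrite -natr1; field.
by rewrite sinB sinD; field.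
Qed.

Let is_derive_cos_sqr_sum n x :
  is_derive x 1 (fun y => cos_sqr_sum n y - (pi * y / 2 - y ^+ 2 / 4)) (err n x).
Proof.
rewrite /err; apply: is_derive1B.
  apply: is_derive1_sum => k.
  have -> : sin (k%:R * x) / k%:R = k%:R ^- 2 * (0 - - sin (k%:R * x) * k%:R) :> R.
    have [->|k0] := eqVneq (k%:R : R) 0; first by rewrite mul0r sin0; ring.
    by field.
  under eq_fun do rewrite mulrC.
  by apply: is_derive1Z; apply: is_derive1B; exact: is_derive1_cosM.
have -> : (pi - x) / 2 = pi / 2 - 4^-1 * (x * 1 + x * 1) by field.
have -> : (fun y => pi * y / 2 - y ^+ 2 / 4) =
    (fun y : R => pi / 2 * y - 4^-1 * (y * y)).
  by apply/funext => y; field.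
apply: is_derive1B; first exact: is_derive1_lin.
Qed.

Let is_derive_err n x :
  is_derive x 1 (err n) (2^-1 + \sum_(1 <= k < n.+1) cos (k%:R * x)).
Proof.
rewrite [X in is_derive _ _ _ X](_ : _ =
  \sum_(1 <= k < n.+1) cos (k%:R * x) - 2^-1 * (0 - 1)); last by field.
apply: is_derive1B.
  under eq_big_nat => k /andP[k0 _].
    rewrite (_ : cos (k%:R * x) = k%:R^-1 * (cos (k%:R * x) * k%:R)); last first.
      by rewrite mulrCA mulVf ?mulr1// pnatr_eq0 -lt0n.
    over.
  apply: is_derive1_sum => k.
  under eq_fun do rewrite mulrC.
  by apply: is_derive1Z; exact: is_derive1_sinM.
under eq_fun do rewrite mulrC.
by apply: is_derive1Z; apply: is_derive1B.
Qed.

Lemma cos_half_odd n : cos ((n%:R + 2^-1) * pi) = 0 :> R.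
Proof.
elim: n => [|n IH]; first by rewrite add0r mulrC cos_pihalf.
rewrite -natr1 [X in cos X](_ : _ = (n%:R + 2^-1) * pi + pi); last by ring.
by rewrite cosDpi IH oppr0.
Qed.

Lemma sinDnpi x (n : nat) : sin (x + n%:R * pi) = (-1) ^+ n * sin x.
Proof.
elim: n => [|n IH]; first by rewrite mul0r addr0 mul1r.
by rewrite -natr1 mulrDl mul1r addrA sinDpi IH exprS mulN1r mulNr.
Qed.

Lemma cosDnpi x (n : nat) : cos (x + n%:R * pi) = (-1) ^+ n * cos x.
Proof.
elim: n => [|n IH]; first by rewrite mul0r addr0 mul1r.
by rewrite -natr1 mulrDl mul1r addrA cosDpi IH exprS mulN1r mulNr.
Qed.

Lemma sin_nat_pi n : sin (n%:R * pi) = 0 :> R.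
Proof. by rewrite -[X in sin X]add0r sinDnpi sin0 mulr0. Qed.

Lemma cos_mul_dist c x y : cos (c * `|x - y|) = cos (c * x - c * y) :> R.
Proof.
have [_|_] := ger0P (x - y); first by congr cos; ring.
by rewrite -[LHS]cosN; congr cos; ring.
Qed.

Let err_pi n : err n pi = 0.
Proof.
rewrite /err subrr mul0r subr0 big1// => k _.
by rewrite sin_nat_pi mul0r.
Qed.

Lemma sin_half_ge d x : 0 < d -> d <= x <= 2 * pi - d ->
  sin (d / 2) <= sin (x / 2) :> R.
Proof.
move=> d0 /andP[dx xd].
have pi0 := @pi_gt0 R.
have [xpi|xpi] := leP x pi.
  by rewrite leNgt ltr_sin -?leNgt ?in_itv/=; lra.
have -> : sin (x / 2) = sin (pi - x / 2).
  by rewrite sinB sinpi cospi; ring.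
by rewrite leNgt ltr_sin -?leNgt ?in_itv/=; lra.
Qed.

(** The derivative of [err n] is the Dirichlet kernel
    sin ((n + 1/2) x) / (2 sin (x / 2)). An integration by parts gains a
    factor 1 / n away from 0 and 2 pi, where the denominator vanishes. The base
    point is pi, at which both [err n] and the boundary term are 0. *)
Let err_bound n d x : 0 < d -> d <= x <= 2 * pi - d ->
  `|err n x| <= (pi + 1) * sin (d / 2) ^- 2 / n.+1%:R.
Proof.
move=> d0 dx; set s := sin (d / 2).
have pi0 := @pi_gt0 R.
have dpi : d <= pi by move/andP: dx => [? ?]; lra.
have s0 : 0 < s by apply: sin_gt0_pi; apply/andP; split; lra.
have s1 : s <= 1 by exact: sin_le1.
pose N : R := n%:R + 2^-1.
have n0 : 0 <= n%:R :> R by [].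
have N0 : 0 < N by rewrite /N; lra.
have sy y : d <= y <= 2 * pi - d -> s <= sin (2^-1 * y).
  by move=> dy; rewrite mulrC; exact: sin_half_ge.
have syp y : d <= y <= 2 * pi - d -> 0 < sin (2^-1 * y).
  by move=> /sy; exact: lt_le_trans.
have sy0 y : d <= y <= 2 * pi - d -> sin (2^-1 * y) != 0.
  by move=> /syp /gt_eqF ->.
(* [q] is [err n] plus the boundary term of the integration by parts: the
   oscillating part of the derivative cancels, [dq] is of size 1 / N. *)
pose q y := err n y + (2 * N)^-1 * (cos (N * y) * (sin (2^-1 * y))^-1).
pose dq y := - ((4 * N)^-1 * (cos (N * y) * cos (2^-1 * y) * sin (2^-1 * y) ^- 2)).
have qd y : d <= y <= 2 * pi - d -> is_derive y 1 q (dq y).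
  move=> dy; rewrite [X in is_derive _ _ _ X](_ : _ =
    (2^-1 + \sum_(1 <= k < n.+1) cos (k%:R * y)) +
    (2 * N)^-1 * (cos (N * y) * (- sin (2^-1 * y) ^- 2 * (cos (2^-1 * y) * 2^-1))
       + (sin (2^-1 * y))^-1 * (- sin (N * y) * N))).
    apply: is_derive1D; first exact: is_derive_err.
    apply: is_derive1Z; apply: is_derive1M; first exact: is_derive1_cosM.
    by apply: is_derive1V; [exact: sy0|exact: is_derive1_sinM].
  have := dirichlet_kernel n y; rewrite [y / 2]mulrC -/N => /(canRL (mulKf (sy0 _ dy))) ->.
  by rewrite /dq; field; rewrite sy0//= gt_eqF.
have dqb y : d <= y <= 2 * pi - d -> `|dq y| <= s ^- 2 / n.+1%:R.
  move=> dy; rewrite /dq normrN !normrM (gtr0_norm (x := _^-1)) ?invr_gt0 ?mulr_gt0//.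
  rewrite (gtr0_norm (x := _^-1)) ?invr_gt0 ?exprn_gt0 ?syp//.
  have sinv : 0 < sin (2^-1 * y) ^- 2 by rewrite invr_gt0 exprn_gt0 ?syp.
  rewrite mulrC; apply: ler_pM.
  - by rewrite mulr_ge0 ?mulr_ge0// ltW.
  - by rewrite invr_ge0 mulr_ge0// ltW.
  - rewrite -[leRHS]mul1r; apply: ler_pM; rewrite ?mulr_ge0 ?(ltW sinv)//.
    + by rewrite -[leRHS]mulr1 ler_pM// cos_max.
    + rewrite lef_pV2 ?posrE ?exprn_gt0 ?syp//.
      by rewrite lerXn2r ?nnegrE ?sy// ltW// syp.
  - by rewrite lef_pV2 ?posrE// ?mulr_gt0// -natr1 /N; lra.
have pid : d <= pi <= 2 * pi - d by apply/andP; split; lra.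
have := lipschitz_of_derive1 qd dqb dx pid.
have -> : q pi = 0 by rewrite /q err_pi cos_half_odd mul0r mulr0 addr0.
rewrite subr0 => qx.
have xpi : `|x - pi| <= pi by rewrite ler_norml; apply/andP; split; lra.
have -> : err n x = q x - (2 * N)^-1 * (cos (N * x) * (sin (2^-1 * x))^-1).
  by rewrite /q addrK.
apply: (le_trans (ler_normB _ _)).
have -> : (pi + 1) * s ^- 2 / n.+1%:R = pi * s ^- 2 / n.+1%:R + s ^- 2 / n.+1%:R.
  by rewrite -mulrA mulrDl mul1r mulrA.
apply: lerD.
  apply: (le_trans qx); rewrite mulrC -mulrA ler_wpM2r//.
  by rewrite mulr_ge0// invr_ge0 exprn_ge0// ltW.
rewrite !normrM mulrC ler_pM ?mulr_ge0//.
- rewrite -[leRHS]mul1r ler_pM// ?cos_max//.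
  rewrite normfV lef_pV2 ?posrE ?exprn_gt0 ?normr_gt0 ?sy0// gtr0_norm ?syp//.
  rewrite (le_trans _ (sy _ dx))// expr2 ler_piMl// ltW//.
- rewrite gtr0_norm ?invr_gt0 ?mulr_gt0// lef_pV2 ?posrE// ?mulr_gt0// -natr1 /N; lra.
Qed.

Lemma cos_sqr_sumS n x : cos_sqr_sum n.+1 x =
  cos_sqr_sum n x + (1 - cos (n.+1%:R * x)) / n.+1%:R ^+ 2.
Proof. by rewrite /cos_sqr_sum big_nat_recr. Qed.

Lemma cos_sqr_sum0 n : cos_sqr_sum n 0 = 0.
Proof.
by rewrite /cos_sqr_sum big1// => k _; rewrite mulr0 cos0 subrr mul0r.
Qed.

(** Telescoping: 1 / k^2 <= 1 / (k - 1) - 1 / k. *)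
Lemma cos_sqr_sum_tail n m x : (0 < m)%N -> (m <= n)%N ->
  0 <= cos_sqr_sum n x - cos_sqr_sum m x <= 2 / m%:R.
Proof.
move=> m0 mn.
suff /andP[-> h] : 0 <= cos_sqr_sum n x - cos_sqr_sum m x <= 2 / m%:R - 2 / n%:R.
  by rewrite (le_trans h)// gerBl.
rewrite -(subnKC mn); elim: (n - m)%N => [|j /andP[IH1 IH2]].
  by rewrite addn0 !subrr lexx.
rewrite addnS cos_sqr_sumS addrAC.
set k := (m + j)%N; have k0 : 0 < k%:R :> R by rewrite ltr0n ltn_addr.
have := cos_max (k.+1%:R * x); rewrite ler_norml => /andP[c1 c2].
apply/andP; split.
  by rewrite addr_ge0// divr_ge0// subr_ge0.
rewrite (le_trans (lerD IH2 (lexx _)))// -addrA lerD2l addrC -lerBrDr opprK.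
have -> : - (2 / k.+1%:R) + 2 / k%:R = 2 / (k%:R * k.+1%:R) :> R.
  by rewrite -natr1; field; rewrite gt_eqF// gt_eqF ?addr_gt0.
rewrite ler_pM ?invr_ge0 ?subr_ge0//; first by lra.
rewrite lef_pV2 ?posrE ?exprn_gt0 ?mulr_gt0// expr2.
by rewrite ler_wpM2r// ler_nat.
Qed.

Lemma cos_sqr_sum_le4 n x : `|cos_sqr_sum n x| <= 4.
Proof.
case: n => [|n]; first by rewrite /cos_sqr_sum big_geq ?normr0.
have /andP[h1 h2] := @cos_sqr_sum_tail n.+1 1 x isT isT.
move: h1 h2; rewrite {2 4}/cos_sqr_sum big_nat1 mul1r expr1n !divr1.
have := cos_max x; rewrite ler_norml => /andP[c1 c2] h1 h2.
by rewrite ger0_norm; lra.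
Qed.

(** Let [h n] be the remainder. By [err_bound] its derivative tends to 0
    uniformly away from 0 and 2 pi, so [h n x - h n d] tends to 0 for
    0 < d <= x. The value [h n d] is small for small [d]: it is within
    2 / m of [h m d] for all n >= m, and [h m] is continuous with [h m 0 = 0].
    At the two end points all the terms vanish. *)
Lemma cvg_cos_sqr_sum x : 0 <= x <= 2 * pi ->
  cos_sqr_sum n x @[n --> \oo] --> pi * x / 2 - x ^+ 2 / 4.
Proof.
move=> /andP[]; rewrite le_eqVlt => /predU1P[<- _|x0].
  rewrite mulr0 mul0r expr0n/= mul0r subrr.
  by under eq_fun do rewrite cos_sqr_sum0; exact: cvg_cst.
rewrite le_eqVlt => /predU1P[->|x2pi].
  rewrite (_ : _ - _ = 0); last by field.
  rewrite (_ : (fun n => _) = cst 0); first exact: cvg_cst.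
  apply/funext => n; rewrite /cos_sqr_sum big1// => k _.
  have -> : k%:R * (2 * pi) = k%:R * pi + k%:R * pi :> R by ring.
  by rewrite cosD -!expr2 cos2sin2 !sin_nat_pi expr0n/= !subr0 subrr mul0r.
pose h n y := cos_sqr_sum n y - (pi * y / 2 - y ^+ 2 / 4).
have hd n y : is_derive y 1 (h n) (err n y) by exact: is_derive_cos_sqr_sum.
apply/cvgrPdist_le => e e0.
pose m := Num.truncn (8 / e).
have me : 2 / m.+1%:R <= e / 4.
  rewrite ler_pdivrMr// -ler_pdivrMl ?divr_gt0// invf_div mulrC.
  rewrite (_ : 2 * _ = 8 / e); last by field; rewrite gt_eqF.
  by rewrite ltW// truncnS_gt.
have [r /= r0 hr] : exists2 r, 0 < r & forall y, `|y| < r -> `|h m.+1 y| <= e / 4.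
  have /cvgrPdist_le/(_ (e / 4)) := is_derive1_continuous (hd m.+1 0).
  have -> : h m.+1 0 = 0 by rewrite /h cos_sqr_sum0; ring.
  rewrite divr_gt0// => /(_ isT)[r /= r0 hr].
  exists r => // y yr; have := hr y; rewrite /= !sub0r !normrN; exact.
pose d := Num.min (r / 2) (Num.min x (2 * pi - x)).
have d0 : 0 < d by rewrite !lt_min x0 subr_gt0 x2pi divr_gt0.
have dr : d < r.
  by rewrite /d gt_min ltr_pdivrMr// ltr_pMr// ltr1n.
have dx : d <= x by rewrite !ge_min lexx orbT.
have dx2 : d <= 2 * pi - x by rewrite !ge_min lexx !orbT.
have xin : d <= x <= 2 * pi - d by apply/andP; split; lra.
have din : d <= d <= 2 * pi - d by apply/andP; split; lra.
set C := (pi + 1) * sin (d / 2) ^- 2 * `|x - d|.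
near=> n.
have mn : (m.+1 <= n)%N by near: n; exact: nbhs_infty_ge.
have Cn : C / n.+1%:R <= e / 2.
  rewrite ler_pdivrMr// -ler_pdivrMl ?divr_gt0//.
  apply: (@le_trans _ _ n%:R); last by rewrite ler_nat.
  by near: n; exact: nbhs_infty_ger.
have hxd : `|h n x - h n d| <= C / n.+1%:R.
  rewrite /C mulrAC; apply: (@lipschitz_of_derive1 _ _ (err n) d (2 * pi - d)) => //.
  by move=> y yin; exact: err_bound.
have hdm : `|h n d - h m.+1 d| <= 2 / m.+1%:R.
  have -> : h n d - h m.+1 d = cos_sqr_sum n d - cos_sqr_sum m.+1 d by rewrite /h; ring.
  by have /andP[h0 h1] := @cos_sqr_sum_tail n m.+1 d isT mn; rewrite ger0_norm.
have hm := hr d; rewrite gtr0_norm// in hm.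
rewrite distrC -/(h n x).
have -> : h n x = (h n x - h n d) + ((h n d - h m.+1 d) + h m.+1 d) by ring.
rewrite (le_trans (ler_normD _ _))// (_ : e = e / 2 + (e / 4 + e / 4)); last by field.
rewrite lerD ?(le_trans hxd)// (le_trans (ler_normD _ _))// lerD ?(le_trans hdm)//.
exact: hm.
Unshelve. all: by end_near. Qed.

End cosine_series.

(** * Integrals of powers *)

Lemma integrable_mul_bounded d (X : measurableType d) (R : realType)
    (mu : {measure set X -> \bar R}) (D : set X) (f g : X -> R) (M : R) :
  measurable D -> mu.-integrable D (EFin \o f) -> measurable_fun D g ->
  (forall x, D x -> `|g x| <= M) ->
  mu.-integrable D (EFin \o (fun x => f x * g x)).
Proof.
move=> mD fi mg gM.
have mf : measurable_fun D f by case/integrableP : fi => /measurable_EFinP.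
apply: (le_integrable mD _ _ (integrableZl mD M fi)).
  by apply/measurable_EFinP; exact: measurable_funM.
move=> x Dx; rewrite /= lee_fin !normrM mulrC ler_wpM2r//.
by rewrite (le_trans (gM _ Dx))// ler_norm.
Qed.

Lemma integrable_scale d (X : measurableType d) (R : realType)
    (mu : {measure set X -> \bar R}) (D : set X) (f : X -> R) (c : R) :
  measurable D -> mu.-integrable D (EFin \o f) ->
  mu.-integrable D (EFin \o (fun x => c * f x)).
Proof. by move=> mD /(integrableZl mD c); apply: eq_integrable. Qed.

Section power_integrals.
Context {R : realType}.
Notation mu := (@lebesgue_measure R).
Implicit Types (a b p r t u x : R).

(** [f] may be unbounded near [a], as a negative power is near 0: the usual
    theorem is applied on segments that stay away from [a] and exhaust the
    interval, and monotone convergence concludes. *)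
Lemma ge0_FTC2_left_open (f F : R -> R) a b : a < b ->
  (forall x, a < x <= b -> 0 <= f x) ->
  (forall x, a < x <= b -> {for x, continuous f}) ->
  (forall x, a < x <= b -> is_derive x 1 F (f x)) ->
  F x @[x --> a^'+] --> F a ->
  measurable_fun `]a, b] f /\
  (\int[mu]_(x in `]a, b]) (f x)%:E = (F b - F a)%:E)%E.
Proof.
move=> ab f0 cf dF Fa.
pose e n : R := a + (b - a) / n.+2%:R.
have ba0 : 0 < b - a by rewrite subr_gt0.
have ae n : a < e n by rewrite ltrDl divr_gt0.
have eb n : e n < b.
  by rewrite /e -ltrBrDl ltr_pdivrMr// ltr_pMr// ltr1n.
have e_cvg : e n @[n --> \oo] --> a.
  rewrite -[X in _ --> X]addr0 -(mulr0 (b - a)).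
  apply: cvgD; first exact: cvg_cst.
  apply: cvgM; first exact: cvg_cst.
  by have := @cvg_harmonic R; rewrite -(cvg_shiftn 1); under eq_fun do rewrite addn1.
have eitv n x : e n <= x <= b -> a < x <= b.
  by move=> /andP[ex ->]; rewrite (lt_le_trans (ae n) ex).
have cfn n : {within `[e n, b], continuous f}.
  apply: continuous_in_subspaceT => x /[!inE]/=; rewrite in_itv/= => /eitv; exact: cf.
have mfn n : measurable_fun `[e n, b] f.
  by apply: subspace_continuous_measurable_fun.
have cupE : \bigcup_n `[e n, b]%classic = `]a, b]%classic.
  apply/seteqP; split => [x [n _ /=]|x /=]; rewrite !in_itv/=; first exact: eitv.
  move=> /andP[ax xb].
  have /cvgr_lt/(_ x ax) [N _ /(_ N (leqnn N)) eNx] := e_cvg.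
  by exists N => //=; rewrite in_itv/= (ltW eNx).
have mf : measurable_fun `]a, b] f.
  by rewrite -cupE; apply/measurable_fun_bigcup.
split => //.
have In n : (\int[mu]_(x in `[e n, b]) (f x)%:E = (F b - F (e n))%:E)%E.
  rewrite (@continuous_FTC2 _ f F)//.
  - split.
    + move=> x; rewrite in_itv/= => /andP[ex xb].
      by have /dF[] : a < x <= b by rewrite (lt_trans (ae n))//= ltW.
    + apply: cvg_at_right_filter; apply: is_derive1_continuous (dF _ _).
      by rewrite ae ltW.
    + apply: cvg_at_left_filter; apply: is_derive1_continuous (dF _ _).
      by rewrite ab lexx.
  - move=> x; rewrite in_itv/= => /andP[ex xb]; rewrite derive1E.
    by have /dF[_ ->] : a < x <= b by rewrite (lt_trans (ae n))//= ltW.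
have h1 : (\int[mu]_(x in `[e n, b]) (f x)%:E)%E @[n --> \oo] -->
    (\int[mu]_(x in `]a, b]) (f x)%:E)%E.
  rewrite -cupE; apply: ge0_nondecreasing_set_cvg_integral => //.
  - apply/nondecreasing_seqP => n; rewrite subsetEset; apply: subset_itvr.
    rewrite bnd_simp lerD2l ler_wpM2l ?(ltW ba0)// lef_pV2 ?posrE//.
    by rewrite ler_nat.
  - by move=> n; apply/measurable_EFinP; exact: mfn.
  - by move=> n x /=; rewrite in_itv/= => /eitv/f0.
have h2 : (\int[mu]_(x in `[e n, b]) (f x)%:E)%E @[n --> \oo] --> (F b - F a)%:E.
  under eq_fun do rewrite In; apply/fine_cvgP; split; first exact: nearW.
  apply: cvgB; first exact: cvg_cst.
  by move/cvg_at_rightP : Fa; apply.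
exact: (cvg_unique _ h1 h2).
Qed.

Lemma integral_powR a x : -1 < a -> 0 < x ->
  (\int[mu]_(t in `]0%R, x]) (t `^ a)%:E = (x `^ (a + 1) / (a + 1))%:E)%E.
Proof.
move=> a1 x0; have a10 : 0 < a + 1 by lra.
have [||||_ ->] := @ge0_FTC2_left_open (fun t => t `^ a)
    (fun t => (a + 1)^-1 * t `^ (a + 1)) 0 x x0.
- by move=> t _; exact: powR_ge0.
- by move=> t /andP[t0 _]; exact: (is_derive1_continuous (@is_derive1_powR _ a _ t0)).
- move=> t /andP[t0 _]; have := @is_derive1_powR _ (a + 1) _ t0.
  rewrite addrK => /(is_derive1Z (a + 1)^-1).
  by rewrite mulrA mulVf ?mul1r// gt_eqF.
- rewrite powR0 ?gt_eqF// mulr0 -[X in _ --> X](mulr0 (a + 1)^-1).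
  by apply: cvgM; [exact: cvg_cst|exact: powR_cvg0].
by rewrite powR0 ?gt_eqF// mulr0 subr0 mulrC.
Qed.

Lemma integrable_powR a x : -1 < a -> 0 < x ->
  mu.-integrable `]0, x] (EFin \o (fun t => t `^ a)).
Proof.
move=> a1 x0; apply/integrableP; split.
  by apply/measurable_EFinP; apply: measurable_funTS; exact: measurable_powR.
under eq_integral do rewrite /= ger0_norm ?powR_ge0//.
by rewrite integral_powR// ltry.
Qed.

Lemma measurable_cosM p (D : set R) : measurable_fun D (fun t => cos (p * t)).
Proof.
apply: measurable_funTS; apply: continuous_measurable_fun => t.
exact: is_derive1_continuous (is_derive1_cosM p t).
Qed.

Lemma normr_sin_le x : `|sin x| <= `|x|.
Proof.
have := @lipschitz_of_derive1 R (fun y => sin (1 * y)) (fun y => cos (1 * y) * 1)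
  (- `|x|) `|x| 1 _ _ x 0.
rewrite mulr0 sin0 !subr0 !mul1r; apply.
- by move=> y _; exact: is_derive1_sinM.
- by move=> y _; rewrite mulr1 cos_max.
- by rewrite -ler_norml.
- by rewrite oppr_le0 !normr_ge0.
Qed.

(** * Sign of the cosine integrals of a negative power *)

Section cosine_transform_ge0.
Variables (a p : R).
Hypotheses (a_gtN1 : -1 < a) (a_lt0 : a < 0) (p_gt0 : 0 < p).

Let f t := t `^ a * cos (p * t).

Let fi x : 0 < x -> mu.-integrable `]0, x] (EFin \o f).
Proof.
move=> x0; apply: (@integrable_mul_bounded _ _ _ _ _ _ _ 1) => //.
- exact: integrable_powR.
- exact: measurable_cosM.
- by move=> t _; exact: cos_max.
Qed.

(** What remains of the integral of [f] after an integration by parts. Its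
    derivative [dJ] involves the weight x^(a-1), which is positive and
    decreasing: this is how the convexity of x^a is used. *)
Let J x := \int[mu]_(t in `]0, x]) f t - p^-1 * (x `^ a * sin (p * x)).

Let dJ x := (- a / p) * (x `^ (a - 1) * sin (p * x)).

Let is_derive_J x : 0 < x -> is_derive x 1 J (dJ x).
Proof.
move=> x0.
have cf : {for x, continuous f}.
  have := is_derive1M (@is_derive1_powR _ a _ x0) (is_derive1_cosM p x).
  exact: is_derive1_continuous.
have x1 : x < x + 1 by rewrite ltrDl.
have [dw w'] := @continuous_FTC1 R f (BRight 0) x (x + 1) x1
  (fi (addr_gt0 x0 ltr01)) x0 cf.
rewrite [X in is_derive _ _ _ X](_ : _ = f x -
    p^-1 * (x `^ a * (cos (p * x) * p) + sin (p * x) * (a * x `^ (a - 1)))); last first.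
  by rewrite /dJ /f; field; rewrite gt_eqF.
apply: is_derive1B.
  by rewrite -w' derive1E; exact: derivableP.
apply: is_derive1Z; apply: is_derive1M; first exact: is_derive1_powR.
exact: is_derive1_sinM.
Qed.

Let J0 : J 0 = 0.
Proof.
by rewrite /J set_itv_ge ?bnd_simp// Rintegral_set0 powR0 ?lt_eqF// mul0r mulr0 subr0.
Qed.

Let J_bound x : 0 < x -> `|J x| <= ((a + 1)^-1 + 1) * x `^ (a + 1).
Proof.
move=> x0; rewrite mulrDl mul1r (le_trans (ler_normB _ _))// lerD//.
  rewrite (le_trans (le_normr_Rintegral _ (fi x0)))//.
  have -> : (a + 1)^-1 * x `^ (a + 1) = \int[mu]_(t in `]0, x]) (t `^ a).
    by rewrite /Rintegral integral_powR//= mulrC.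
  apply: le_Rintegral => //.
  - by have := fi x0; move/integrable_abse.
  - exact: integrable_powR.
  - move=> t _; rewrite normrM ger0_norm ?powR_ge0//.
    by rewrite ler_piMr ?powR_ge0// cos_max.
rewrite powRD ?(gt_eqF x0) ?implybT// powRr1 ?(ltW x0)// !normrM.
rewrite (ger0_norm (powR_ge0 _ _)) mulrCA ler_wpM2l ?powR_ge0//.
rewrite normfV (gtr0_norm p_gt0) ler_pdivrMl// (le_trans (normr_sin_le _))//.
by rewrite normrM !gtr0_norm.
Qed.

Let J_continuous x : 0 < x -> {within `[0, x], continuous J}.
Proof.
move=> x0; apply/(continuous_within_itvP _ x0); split.
- by move=> t; rewrite in_itv/= => /andP[/is_derive_J/is_derive1_continuous].
- rewrite J0; have cp : (fun t => ((a + 1)^-1 + 1) * t `^ (a + 1)) t @[t --> 0^'+] --> (0 : R).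
    rewrite -[X in _ --> X](mulr0 ((a + 1)^-1 + 1)).
    by apply: cvgM; [exact: cvg_cst|apply: powR_cvg0; rewrite -ltrBlDr sub0r].
  apply: (squeeze_cvgr _ (_ :
    (fun t => - (((a + 1)^-1 + 1) * t `^ (a + 1))) t @[t --> 0^'+] --> (0 : R)) cp).
    by near=> t; rewrite -ler_norml; apply: J_bound.
  rewrite -[X in _ --> X]oppr0; exact: (@cvgN _ R^o).
- apply: cvg_at_left_filter; exact: is_derive1_continuous (is_derive_J x0).
Unshelve. all: by end_near. Qed.

Let weight_le u x : 0 < u -> u <= x -> x `^ (a - 1) <= u `^ (a - 1).
Proof.
move=> u0 ux; have x0 := lt_le_trans u0 ux.
have -> : a - 1 = - (1 - a) by ring.
rewrite !powRN lef_pV2 ?posrE ?powR_gt0//.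
apply: ge0_ler_powR; rewrite ?nnegrE ?(ltW u0) ?(ltW x0)//.
by rewrite subr_ge0 ltW// (lt_trans a_lt0).
Qed.

Let sin_sign (n : nat) x : n%:R * pi <= p * x <= n.+1%:R * pi ->
  0 <= (-1) ^+ n * sin (p * x).
Proof.
move=> /andP[h1 h2]; rewrite -[p * x](subrK (n%:R * pi)) sinDnpi mulrA.
rewrite -expr2 sqrr_sign mul1r sin_ge0_pi// subr_ge0 h1 lerBlDr.
by rewrite (le_trans h2)// -natr1; lra.
Qed.

Let node (n : nat) := n%:R * pi / p.

Let node_lt n : node n < node n.+1.
Proof. by rewrite /node ltr_pM2r ?invr_gt0// ltr_pM2r ?pi_gt0// ltr_nat. Qed.

Let node_ge0 n : 0 <= node n.
Proof. by rewrite /node divr_ge0 ?mulr_ge0 ?pi_ge0// ltW. Qed.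

Let p_node n : p * node n = n%:R * pi.
Proof. by rewrite /node; field; rewrite gt_eqF. Qed.

Let node_itv n x : node n < x < node n.+1 ->
  0 < x /\ n%:R * pi <= p * x <= n.+1%:R * pi.
Proof.
move=> /andP[nx xn]; split; first exact: le_lt_trans (node_ge0 n) nx.
by rewrite -!p_node !ler_pM2l// !ltW.
Qed.

(** On an interval where the sine has a constant sign, replacing the weight by
    a constant [w] that is below it (where the sine is positive) or above it
    (where the sine is negative) decreases the derivative of [J], and the
    replacement integrates to a cosine. *)
Let J_node_step n (w : R) :
  (forall x, node n < x < node n.+1 ->
     0 <= (-1) ^+ n * (x `^ (a - 1) - w)) ->
  J (node n) + - a / p * (w * cos (p * node n) / p)
  <= J (node n.+1) + - a / p * (w * cos (p * node n.+1) / p).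
Proof.
move=> hw.
pose K x := J x + - a / p * (w / p * cos (p * x)).
have dK x : 0 < x -> is_derive x 1 K
    (- a / p * ((x `^ (a - 1) - w) * sin (p * x))).
  move=> x0; rewrite [X in is_derive _ _ _ X](_ : _ =
    dJ x + - a / p * (w / p * (- sin (p * x) * p))); last first.
    by rewrite /dJ; field; rewrite gt_eqF.
  apply: is_derive1D; first exact: is_derive_J.
  by do 2 apply: is_derive1Z; exact: is_derive1_cosM.
suff : K (node n) <= K (node n.+1) by rewrite /K ![w / p * _]mulrAC.
have itvE x : (x \in `]node n, node n.+1[) = (node n < x < node n.+1) by rewrite in_itv.
apply: (@ger0_derive1_ndecr R K (node n) (node n.+1)); rewrite ?lexx ?(ltW (node_lt n))//.
- by move=> x; rewrite itvE => /node_itv[/dK[]].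
- move=> x; rewrite itvE => xn; have [x0 hx] := node_itv xn.
  have [_ Kx] := dK x x0; rewrite derive1E Kx.
  rewrite mulr_ge0 ?divr_ge0 ?oppr_ge0 ?(ltW a_lt0) ?(ltW p_gt0)//.
  have := mulr_ge0 (hw _ xn) (sin_sign hx).
  by rewrite mulrACA -expr2 sqrr_sign mul1r.
- have n0 := le_lt_trans (node_ge0 n) (node_lt n).
  apply: (@continuous_subspaceW _ _ _ `[0, node n.+1]).
    by apply: subset_itvr; rewrite bnd_simp.
  have cJ := J_continuous n0.
  have cC : {within `[0, node n.+1], continuous (fun x => - a / p * (w / p * cos (p * x)))}.
    apply: continuous_subspaceT => x.
    apply: is_derive1_continuous; do 2 apply: is_derive1Z; exact: is_derive1_cosM.
  by move=> x; apply: cvgD; [exact: cJ|exact: cC].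
Qed.

(** Over a full period of the sine take for [w] the weight at the middle node:
    the weight is larger before it and smaller after it, and the cosine terms
    at the two ends of the period are equal. *)
Let J_even_node_ge0 (i : nat) : 0 <= J (node i.*2).
Proof.
elim: i => [|i IH]; first by rewrite /node mul0r mul0r J0.
rewrite (le_trans IH)//.
have m0 : 0 < node i.*2.+1 := le_lt_trans (node_ge0 _) (node_lt _).
have h1 := @J_node_step i.*2 (node i.*2.+1 `^ (a - 1)).
have h2 := @J_node_step i.*2.+1 (node i.*2.+1 `^ (a - 1)).
have s2 : (-1) ^+ i.*2 = 1 :> R by rewrite -signr_odd odd_double.
have cE n : cos (p * node n) = (-1) ^+ n.
  by rewrite p_node -[_ * pi]add0r cosDnpi cos0 mulr1.
move: h1 h2; rewrite doubleS !cE !exprS s2 !mulN1r opprK => h1 h2.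
rewrite -(lerD2r (- a / p * (node i.*2.+1 `^ (a - 1) * 1 / p))).
apply: (le_trans (h1 _) (h2 _)) => x /[dup] xn /node_itv[x0 _]; case/andP: xn => ? ?.
- by rewrite mul1r subr_ge0 weight_le// ltW.
- by rewrite mulN1r opprB subr_ge0 weight_le// ltW.
Qed.

Lemma cosine_transform_powR_ge0 (n : nat) :
  0 <= \int[mu]_(t in `]0, n%:R * pi / p]) (t `^ a * cos (p * t)).
Proof.
suff : 0 <= J (node n).
  by rewrite /J p_node sin_nat_pi !mulr0 subr0.
rewrite -(odd_double_half n); case: (odd n); last exact: J_even_node_ge0.
(* For odd n a half period is left, on which the sine is positive: w = 0. *)
rewrite add1n (le_trans (J_even_node_ge0 n./2))//.
have := @J_node_step n./2.*2 0; rewrite !mul0r !mulr0 !addr0; apply=> x _.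
by rewrite subr0 -signr_odd odd_double mul1r powR_ge0.
Qed.

End cosine_transform_ge0.

End power_integrals.

(** * Limit of the variance series *)

Section fractional_kernel.
Context {R : realType}.
Notation mu := (@lebesgue_measure R).
Implicit Types (a t u x : R).

Lemma measurable_ramp (D : set R) u :
  measurable_fun D (fun t => Num.max (u - t) 0).
Proof.
by apply: measurable_funTS; apply: measurable_maxr => //; exact: measurable_funB.
Qed.

Lemma integrable_powR_ramp a T u : -1 < a -> 0 < T -> 0 <= u ->
  mu.-integrable `]0, T] (EFin \o (fun t => t `^ a * Num.max (u - t) 0)).
Proof.
move=> a1 T0 u0; apply: (@integrable_mul_bounded _ _ _ _ _ _ _ u) => //.
- exact: integrable_powR.
- exact: measurable_ramp.
- move=> t /=; rewrite in_itv/= => /andP[t0 tT].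
  rewrite ger0_norm ?le_max ?lexx ?orbT// ge_max u0 andbT.
  by rewrite gerBl ltW.
Qed.

Lemma Rintegral_powR_ramp a T u : -1 < a -> 0 < T -> 0 <= u <= T ->
  \int[mu]_(t in `]0, T]) (t `^ a * Num.max (u - t) 0) =
  u `^ (a + 2) / ((a + 1) * (a + 2)).
Proof.
move=> a1 T0 /andP[u0 uT].
have a10 : 0 < a + 1 by lra.
have a20 : 0 < a + 2 by lra.
have int := integrable_powR_ramp a1 T0 u0.
have zero : \int[mu]_(t in `]u, T]) (t `^ a * Num.max (u - t) 0) = 0.
  rewrite (@eq_Rintegral _ _ _ _ _ (cst 0)); first by rewrite Rintegral_cst// mul0r.
  move=> t; rewrite inE/= in_itv/= => /andP[ut _].
  by rewrite max_r ?mulr0// subr_le0 ltW.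
have := @Rintegral_itvB R _ (BRight 0) (BRight T) u int.
rewrite !bnd_simp => /(_ u0 uT); rewrite zero => /eqP; rewrite subr_eq0 => /eqP ->.
move: u0; rewrite le_eqVlt => /predU1P[<-|u0].
  by rewrite set_itv_ge ?bnd_simp// Rintegral_set0 powR0 ?gt_eqF// mul0r.
transitivity (\int[mu]_(t in `]0, u]) (t `^ a * (u - t))).
  apply: eq_Rintegral => t; rewrite inE/= in_itv/= => /andP[_ tu].
  by rewrite max_l// subr_ge0.
have dpow b t : 0 < t -> is_derive t 1 (fun s => s `^ b) (b * t `^ (b - 1)).
  exact: is_derive1_powR.
rewrite /Rintegral; have [||||_ ->] := @ge0_FTC2_left_open R (fun t => t `^ a * (u - t))
    (fun t => u / (a + 1) * t `^ (a + 1) - (a + 2)^-1 * t `^ (a + 2)) 0 u u0.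
- by move=> t /andP[t0 tu]; rewrite mulr_ge0 ?powR_ge0// subr_ge0.
- move=> t /andP[t0 _]; apply: is_derive1_continuous.
  by apply: is_derive1M; exact: dpow.
- move=> t /andP[t0 _].
  rewrite [X in is_derive _ _ _ X](_ : _ =
    u / (a + 1) * ((a + 1) * t `^ (a + 1 - 1)) - (a + 2)^-1 * ((a + 2) * t `^ (a + 2 - 1))).
    by apply: is_derive1B; apply: is_derive1Z; exact: dpow.
  rewrite addrK (_ : a + 2 - 1 = a + 1); last by ring.
  rewrite powRD ?(gt_eqF t0) ?implybT// powRr1 ?(ltW t0)//; field.
  by rewrite !gt_eqF.
- rewrite !powR0 ?gt_eqF// !mulr0 subr0 -[X in _ --> X]subr0.
  rewrite -[X in _ --> X - _](mulr0 (u / (a + 1))) -[X in _ --> _ - X](mulr0 (a + 2)^-1).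
  by apply: cvgB; apply: cvgM;
    [exact: cvg_cst|exact: powR_cvg0|exact: cvg_cst|exact: powR_cvg0].
rewrite /= !powR0 ?gt_eqF// !mulr0 !subr0 (_ : a + 2 = a + 1 + 1); last by ring.
rewrite [u `^ (a + 1 + 1)]powRD ?(gt_eqF u0) ?implybT// powRr1 ?(ltW u0)//; field.
by rewrite (gt_eqF a10) (gt_eqF (addr_gt0 a10 ltr01)).
Qed.

Definition variance_sum (T H : R) (n : nat) u : R :=
  \sum_(1 <= k < n.+1)
    (T / (k%:R * pi) * Num.sqrt (- (cos_coef T H k / 2))) ^+ 2 *
    (1 - cos (k%:R * pi * u / T)).

Section variance_series.
Variables (T H u : R).
Hypotheses (T0 : 0 < T) (hH : 1 / 2 < H < 1) (hu : 0 <= u <= T).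

Let a : R := 2 * H - 2.
Let a_gtN1 : -1 < a. Proof. by move/andP: hH => [? ?]; rewrite /a; lra. Qed.
Let a_lt0 : a < 0. Proof. by move/andP: hH => [? ?]; rewrite /a; lra. Qed.
Let c0 : 0 < 2 * H * (2 * H - 1).
Proof. by move/andP: hH => [? ?]; apply: mulr_gt0; lra. Qed.

Let gammaE t : gamma_fun H t = - (2 * H * (2 * H - 1)) * t `^ a.
Proof. by []. Qed.

Let gamma_int : mu.-integrable `]0, T] (EFin \o gamma_fun H).
Proof.
by apply: integrable_scale => //; exact: integrable_powR.
Qed.

Lemma cos_coef_le0 k : (0 < k)%N -> cos_coef T H k <= 0.
Proof.
move=> k0; have p0 : 0 < k%:R * pi / T :> R.
  by rewrite divr_gt0// mulr_gt0// ?ltr0n ?pi_gt0.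
have := @cosine_transform_powR_ge0 R a _ a_gtN1 a_lt0 p0 k.
rewrite (_ : k%:R * pi / (k%:R * pi / T) = T); last first.
  rewrite invf_div mulrCA divff ?mulr1// mulf_neq0 ?(gt_eqF (pi_gt0 R))//.
  by rewrite pnatr_eq0 -lt0n.
move=> F0; rewrite /cos_coef.
rewrite mulr_ge0_le0 ?divr_ge0 ?(ltW T0)//.
have -> : \int[mu]_(t in `]0, T]) (gamma_fun H t * cos (k%:R * pi * t / T)) =
    \int[mu]_(t in `]0, T])
      (- (2 * H * (2 * H - 1)) * (t `^ a * cos (k%:R * pi / T * t))).
  by apply: eq_Rintegral => t _; rewrite gammaE mulrA [_ * pi * _ / T]mulrAC.
rewrite RintegralZl//.
  by rewrite mulr_le0_ge0// oppr_le0 ltW.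
apply: (@integrable_mul_bounded _ _ _ _ _ _ _ 1) => //.
- exact: integrable_powR.
- exact: measurable_cosM.
- by move=> t _; exact: cos_max.
Qed.

(** The sum for 1 <= k <= n of cos (k pi t / T) (1 - cos (k pi u / T)) / k^2, by
    the formula 2 cos x cos y = cos (x + y) + cos (x - y); see [KS]. The absolute
    value keeps the arguments of [cos_sqr_sum] inside [0, 2 pi]. *)
Let K n t : R := (cos_sqr_sum n (pi / T * (t + u)) +
  cos_sqr_sum n (pi / T * `|t - u|)) / 2 - cos_sqr_sum n (pi / T * t).

Let KS n t : K n.+1 t = K n t +
  cos (n.+1%:R * pi * t / T) * (1 - cos (n.+1%:R * pi * u / T)) / n.+1%:R ^+ 2.
Proof.
rewrite /K !cos_sqr_sumS.
have -> : cos (n.+1%:R * (pi / T * `|t - u|)) =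
    cos (n.+1%:R * pi * t / T - n.+1%:R * pi * u / T).
  by rewrite mulrA cos_mul_dist; congr cos; ring.
have -> : n.+1%:R * (pi / T * (t + u)) =
    n.+1%:R * pi * t / T + n.+1%:R * pi * u / T by ring.
have -> : n.+1%:R * (pi / T * t) = n.+1%:R * pi * t / T by ring.
rewrite cosD cosB; field.
by rewrite addrC natr1.
Qed.

Let measurable_mode (k : nat) :
  measurable_fun `]0, T] (fun t => cos (k%:R * pi * t / T)).
Proof.
rewrite (_ : (fun t => _) = fun t => cos (k%:R * pi / T * t)).
  exact: measurable_cosM.
by apply/funext => t; rewrite mulrAC.
Qed.

Let measurable_K n : measurable_fun `]0, T] (K n).
Proof.
elim: n => [|n IH].
  rewrite (_ : K 0 = cst 0)//; apply/funext => t.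
  by rewrite /K /cos_sqr_sum !big_geq// addr0 mul0r subr0.
rewrite (funext (KS n)).
apply: measurable_funD => //; apply: measurable_funM => //; apply: measurable_funM => //.
Qed.

Let K_bound n t : `|K n t| <= 8.
Proof.
have h x : - 4 <= cos_sqr_sum n x <= 4 by rewrite -ler_norml cos_sqr_sum_le4.
have /andP[? ?] := h (pi / T * (t + u)); have /andP[? ?] := h (pi / T * `|t - u|).
have /andP[? ?] := h (pi / T * t); rewrite ler_norml /K; apply/andP; split; lra.
Qed.

Let gammaK_int n : mu.-integrable `]0, T] (EFin \o (fun t => gamma_fun H t * K n t)).
Proof.
apply: (@integrable_mul_bounded _ _ _ _ _ _ _ 8) => //.
exact: measurable_K.
Qed.

Let variance_sumE n :
  variance_sum T H n u =
  - (T / pi ^+ 2) * \int[mu]_(t in `]0, T]) (gamma_fun H t * K n t).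
Proof.
rewrite /variance_sum; elim: n => [|n IH].
  rewrite big_geq// (_ : Rintegral _ _ _ = 0) ?mulr0//.
  transitivity (\int[mu]_(t in `]0, T]) cst 0 t).
    apply: eq_Rintegral => t _.
    by rewrite /K /cos_sqr_sum !big_geq// addr0 mul0r subr0 mulr0.
  by rewrite Rintegral_cst// mul0r.
rewrite big_nat_recr//= IH.
set q := (1 - cos (n.+1%:R * pi * u / T)) / n.+1%:R ^+ 2.
transitivity (- (T / pi ^+ 2) * \int[mu]_(t in `]0, T]) (gamma_fun H t * K n t +
   q * (gamma_fun H t * cos (n.+1%:R * pi * t / T)))); last first.
  congr (_ * _); apply: eq_Rintegral => t _.
  by rewrite KS /q; ring.
have ci : mu.-integrable `]0, T]
    (EFin \o (fun t => gamma_fun H t * cos (n.+1%:R * pi * t / T))).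
  apply: (@integrable_mul_bounded _ _ _ _ _ _ _ 1) => //.
    exact: measurable_mode.
  by move=> t _; exact: cos_max.
rewrite RintegralD//; last exact: integrable_scale.
rewrite RintegralZl// [RHS]mulrDr; congr (_ + _).
rewrite exprMn sqr_sqrtr; last by rewrite oppr_ge0 mulr_le0_ge0 ?cos_coef_le0.
rewrite /cos_coef /q; move: (pi) (pi_gt0 R) => P P0; field.
by rewrite nat1r (gt_eqF T0) (gt_eqF P0) pnatr_eq0.
Qed.

(** In the limit the terms in t^2 cancel, and t + u + |t - u| - 2 t is twice the
    positive part of u - t. *)
Let K_limit t : R := pi ^+ 2 / (2 * T) * Num.max (u - t) 0 - (pi * u / T) ^+ 2 / 4.

Let cvg_K t : 0 < t <= T -> K n t @[n --> \oo] --> K_limit t.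
Proof.
move=> /andP[t0 tT]; move/andP: hu => [u0 uT].
have pT : 0 < pi / T by rewrite divr_gt0 ?pi_gt0.
have pi0 := pi_gt0 R.
have inpi x : 0 <= x <= 2 * T -> 0 <= pi / T * x <= 2 * pi.
  move=> /andP[x0 x1]; rewrite mulr_ge0 ?(ltW pT)//=.
  by rewrite mulrAC ler_pdivrMr// mulrAC mulrC ler_wpM2r// ltW.
have -> : K_limit t =
  ((pi * (pi / T * (t + u)) / 2 - (pi / T * (t + u)) ^+ 2 / 4) +
   (pi * (pi / T * `|t - u|) / 2 - (pi / T * `|t - u|) ^+ 2 / 4)) / 2 -
  (pi * (pi / T * t) / 2 - (pi / T * t) ^+ 2 / 4).
  rewrite /K_limit; move: (pi) => P; have [tu|/ltW tu] := leP t u.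
    rewrite max_l ?subr_ge0// ler0_norm ?subr_le0//; field.
    by rewrite gt_eqF.
  rewrite max_r ?subr_le0// ger0_norm ?subr_ge0//; field.
  by rewrite gt_eqF.
apply: cvgB; last by apply: cvg_cos_sqr_sum; apply: inpi; lra.
apply: cvgM; last exact: cvg_cst.
apply: cvgD; apply: cvg_cos_sqr_sum; apply: inpi; first by apply/andP; split; lra.
rewrite normr_ge0/= ler_norml; apply/andP; split; lra.
Qed.

Lemma cvg_variance_series :
  variance_sum T H n u @[n --> \oo] -->
  (u `^ (2 * H) - H * T `^ (2 * H - 2) * u ^+ 2) / 2.
Proof.
move/andP: hH => [H1 H2]; rewrite (funext variance_sumE).
have H10 : 2 * H - 1 != 0 by rewrite gt_eqF//; lra.
have H0 : H != 0 by rewrite gt_eqF//; lra.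
have mramp := @measurable_ramp `]0, T] u.
have mlim : measurable_fun `]0, T] K_limit.
  by apply: measurable_funB => //; exact: measurable_funM.
have limE : - (T / pi ^+ 2) * \int[mu]_(t in `]0, T]) (gamma_fun H t * K_limit t) =
    (u `^ (2 * H) - H * T `^ (2 * H - 2) * u ^+ 2) / 2.
  have ramp_int := integrable_powR_ramp a_gtN1 T0 (proj1 (andP hu)).
  pose c := - (2 * H * (2 * H - 1)).
  transitivity (- (T / pi ^+ 2) * \int[mu]_(t in `]0, T])
      ((c * (pi ^+ 2 / (2 * T))) * (t `^ a * Num.max (u - t) 0) -
       (c * ((pi * u / T) ^+ 2 / 4)) * t `^ a)).
    congr (_ * _); apply: eq_Rintegral => t _.
    by rewrite gammaE /K_limit /c; ring.
  rewrite RintegralB//; [|exact: integrable_scale|].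
    2: by apply: integrable_scale => //; exact: integrable_powR.
  rewrite !RintegralZl//; last exact: integrable_powR.
  rewrite Rintegral_powR_ramp// /Rintegral integral_powR//=.
  have aE1 : a + 1 = 2 * H - 1 by rewrite /a; ring.
  have aE2 : a + 2 = 2 * H by rewrite /a; ring.
  have TE : T `^ (a + 1) = T `^ a * T.
    by rewrite powRD ?(gt_eqF T0) ?implybT// powRr1// ltW.
  rewrite TE aE1 aE2 -/a /c; move: (T `^ a) (u `^ _) => X Y.
  have := pi_gt0 R; move: (pi) => P P0; field.
  by rewrite H10 H0 (gt_eqF T0) (gt_eqF P0).
rewrite -limE; apply: cvgM; first exact: cvg_cst.
have [|||||iK _ h] := @dominated_convergence _ _ _ mu `]0, T] (measurable_itv _)
  (fun n t => (gamma_fun H t * K n t)%:E) (fun t => (gamma_fun H t * K_limit t)%:E)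
  (fun t => (8 * `|gamma_fun H t|)%:E).
- by move=> n; case/integrableP : (gammaK_int n).
- apply/measurable_EFinP; apply: measurable_funM => //.
  by case/integrableP : gamma_int => /measurable_EFinP.
- apply: aeW => t; rewrite /= in_itv/= => tT.
  apply/cvg_EFin; first exact: nearW.
  by apply: cvgM; [exact: cvg_cst|exact: cvg_K].
- apply: integrable_scale => //; exact: (integrable_abse gamma_int).
- apply: aeW => t n _; rewrite lee_fin normrM mulrC ler_wpM2r//; exact: K_bound.
have fin : (\int[mu]_(t in `]0%R, T]) (gamma_fun H t * K_limit t)%:E)%E \is a fin_num.
  exact: integrable_fin_num.
by move: h; rewrite -(fineK fin) => /fine_cvgP[_].
Qed.

End variance_series.
End fractional_kernel.

(** * The inner product of square integrable random variables *)

Section square_integrable.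
Context d (Omega : measurableType d) (R : realType) (P : probability Omega R).
Implicit Types (X Y : Omega -> R).
Notation L2 := (Lfun P 2%:E).

Lemma L2_of_sqr X : measurable_fun setT X ->
  (\int[P]_w (X w ^+ 2)%:E < +oo)%E -> X \in L2.
Proof.
move=> mX X2; rewrite inE; apply/andP; split; rewrite inE//=.
rewrite /finite_norm unlock /Lnorm poweR_lty//.
rewrite (_ : integral _ _ _ = \int[P]_w (X w ^+ 2)%:E)%E//.
by apply: eq_integral => w _; rewrite /= powR_mulrn// real_normK ?num_real.
Qed.

Lemma L2_measurable X : X \in L2 -> measurable_fun setT X.
Proof. by rewrite inE => /andP[/[!inE]]. Qed.

Lemma L2D X Y : X \in L2 -> Y \in L2 -> (fun w => X w + Y w) \in L2.
Proof. by have := lee1n 2; move=> h X2 Y2; exact: (@rpredD _ L2 X Y). Qed.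

Lemma L2Z X c : X \in L2 -> (fun w => c * X w) \in L2.
Proof.
move=> X2; have -> : (fun w => c * X w) = c \o* X.
  by apply/funext => w /=; rewrite mulrC.
by apply: Lfun_scale => //; rewrite ler1n.
Qed.

Lemma L2B X Y : X \in L2 -> Y \in L2 -> (fun w => X w - Y w) \in L2.
Proof.
move=> X2 Y2; have -> : (fun w => X w - Y w) = (fun w => X w + -1 * Y w).
  by apply/funext => w; rewrite mulN1r.
exact/L2D/L2Z.
Qed.

Lemma L2_mul_integrable X Y : X \in L2 -> Y \in L2 ->
  P.-integrable setT (EFin \o (fun w => X w * Y w)).
Proof. by move=> X2 Y2; apply/Lfun1_integrable; exact: Lfun2_mul_Lfun1. Qed.

Lemma L2_integrable X : X \in L2 -> P.-integrable setT (EFin \o X).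
Proof.
move=> X2; have X1 := Lfun_subset12 (fin_num_measure P _ measurableT) X2.
exact/Lfun1_integrable.
Qed.

Definition inner X Y : R := \int[P]_w (X w * Y w).

Lemma innerE X Y : X \in L2 -> Y \in L2 ->
  (\int[P]_w (X w * Y w)%:E = (inner X Y)%:E)%E.
Proof.
by move=> X2 Y2; rewrite /inner /Rintegral fineK// integrable_fin_num// L2_mul_integrable.
Qed.

Lemma innerC X Y : inner X Y = inner Y X.
Proof. by apply: eq_Rintegral => w _; rewrite mulrC. Qed.

Lemma innerDl X Y V : X \in L2 -> Y \in L2 -> V \in L2 ->
  inner (fun w => X w + Y w) V = inner X V + inner Y V.
Proof.
move=> X2 Y2 V2; rewrite /inner -RintegralD ?L2_mul_integrable//.
by apply: eq_Rintegral => w _; rewrite mulrDl.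
Qed.

Lemma innerZl c X Y : X \in L2 -> Y \in L2 ->
  inner (fun w => c * X w) Y = c * inner X Y.
Proof.
move=> X2 Y2; rewrite /inner -RintegralZl ?L2_mul_integrable//.
by apply: eq_Rintegral => w _; rewrite mulrA.
Qed.

Lemma innerBl X Y V : X \in L2 -> Y \in L2 -> V \in L2 ->
  inner (fun w => X w - Y w) V = inner X V - inner Y V.
Proof.
move=> X2 Y2 V2; rewrite /inner -RintegralB ?L2_mul_integrable//.
by apply: eq_Rintegral => w _; rewrite mulrBl.
Qed.

Lemma innerBr X Y V : X \in L2 -> Y \in L2 -> V \in L2 ->
  inner V (fun w => X w - Y w) = inner V X - inner V Y.
Proof. by move=> X2 Y2 V2; rewrite !(innerC V) innerBl. Qed.

Lemma innerDr X Y V : X \in L2 -> Y \in L2 -> V \in L2 ->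
  inner V (fun w => X w + Y w) = inner V X + inner V Y.
Proof. by move=> X2 Y2 V2; rewrite !(innerC V) innerDl. Qed.

Lemma innerZr c X Y : X \in L2 -> Y \in L2 ->
  inner Y (fun w => c * X w) = c * inner Y X.
Proof. by move=> X2 Y2; rewrite !(innerC Y) innerZl. Qed.

Lemma inner_ge0 X : 0 <= inner X X.
Proof. by apply: Rintegral_ge0 => w _; rewrite -expr2 sqr_ge0. Qed.

Lemma inner_cauchy_schwarz X Y : X \in L2 -> Y \in L2 ->
  inner X Y ^+ 2 <= inner X X * inner Y Y.
Proof.
move=> X2 Y2; set a := inner X X; set b := inner X Y; set c := inner Y Y.
have quad t : 0 <= a + t * (2 * b) + t ^+ 2 * c.
  have tY2 : (fun w => t * Y w) \in L2 by exact: L2Z.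
  have := inner_ge0 (fun w => X w + t * Y w).
  rewrite innerDl ?L2D// !innerDr// !innerZl// !innerZr// (innerC Y X) -/a -/b -/c.
  by congr (_ <= _); ring.
have a0 : 0 <= a := inner_ge0 X.
have := inner_ge0 Y; rewrite -/c le_eqVlt => /predU1P[c0|c0].
  (* When [c = 0] the map [quad] is affine, so nonnegative only if [b = 0]. *)
  rewrite -c0 mulr0; have [->|b0] := eqVneq b 0; first by rewrite expr0n.
  have := quad (- (a + 1) / (2 * b)); rewrite -c0 mulr0 addr0 divfK ?mulf_neq0//.
  by lra.
(* The minimum of the quadratic map. *)
have := quad (- b / c).
have -> : a + - b / c * (2 * b) + (- b / c) ^+ 2 * c = a - b ^+ 2 / c.
  by field; rewrite gt_eqF.
by rewrite subr_ge0 ler_pdivrMr.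
Qed.

(** With A = X - X_n and B = Y - Y_n, one has
    X_n Y_n = X Y - A Y - X B + A B, and the Cauchy-Schwarz inequality makes
    the inner products of the last three terms vanish in the limit. *)
Lemma cvg_inner X Y (X_ Y_ : nat -> Omega -> R) :
  X \in L2 -> Y \in L2 -> (forall n, X_ n \in L2) -> (forall n, Y_ n \in L2) ->
  inner (fun w => X w - X_ n w) (fun w => X w - X_ n w) @[n --> \oo] --> (0 : R) ->
  inner (fun w => Y w - Y_ n w) (fun w => Y w - Y_ n w) @[n --> \oo] --> (0 : R) ->
  inner (X_ n) (Y_ n) @[n --> \oo] --> inner X Y.
Proof.
move=> X2 Y2 Xn2 Yn2 Xcv Ycv.
pose A n w := X w - X_ n w; pose B n w := Y w - Y_ n w.
have A2 n : A n \in L2 by exact: L2B.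
have B2 n : B n \in L2 by exact: L2B.
have small (U V : nat -> Omega -> R) : (forall n, U n \in L2) -> (forall n, V n \in L2) ->
    inner (U n) (U n) * inner (V n) (V n) @[n --> \oo] --> (0 : R) ->
    inner (U n) (V n) @[n --> \oo] --> (0 : R).
  move=> U2 V2 UV0; apply/cvgr0Pnorm_le => e e0.
  have e20 : 0 < e ^+ 2 by rewrite exprn_gt0.
  move/cvgr0Pnorm_le/(_ _ e20) : UV0; apply: filterS => n UVe.
  rewrite -ler_sqr ?nnegrE ?(ltW e0)// real_normK ?num_real//.
  rewrite (le_trans (inner_cauchy_schwarz (U2 n) (V2 n)))//.
  by rewrite (le_trans (ler_norm _)).
have h1 : inner (A n) Y @[n --> \oo] --> (0 : R).
  apply: (small A (fun=> Y)) => //.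
  by rewrite -[X in _ --> X](mul0r (inner Y Y)); apply: cvgM => //; exact: cvg_cst.
have h2 : inner X (B n) @[n --> \oo] --> (0 : R).
  apply: (small (fun=> X) B) => //.
  by rewrite -[X in _ --> X](mulr0 (inner X X)); apply: cvgM => //; exact: cvg_cst.
have h3 : inner (A n) (B n) @[n --> \oo] --> (0 : R).
  by apply: small => //; rewrite -[X in _ --> X](mulr0 0); exact: cvgM.
have -> : (fun n => inner (X_ n) (Y_ n)) =
    (fun n => inner X Y - inner (A n) Y - inner X (B n) + inner (A n) (B n)).
  apply/funext => n; rewrite (innerBl X2 (Xn2 n) (B2 n)) (innerBl X2 (Xn2 n) Y2).
  by rewrite !(innerBr Y2 (Yn2 n))//; ring.
suff : (fun n => inner X Y - inner (A n) Y - inner X (B n) + inner (A n) (B n)) @ \oo -->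
    inner X Y - 0 - 0 + 0 by rewrite !subr0 addr0.
by apply: cvgD => //; apply: cvgB => //; apply: cvgB => //; exact: cvg_cst.
Qed.

(** The squared distances are finite from some rank N on, and then
    X = (X - X_N) + X_N is a sum of square integrable variables. *)
Lemma cvg_mean_square_inner X (X_ : nat -> Omega -> R) :
  measurable_fun setT X -> (forall n, X_ n \in L2) -> cvg_mean_square P X_ X ->
  X \in L2 /\
  inner (fun w => X w - X_ n w) (fun w => X w - X_ n w) @[n --> \oo] --> (0 : R).
Proof.
move=> mX Xn2; rewrite /cvg_mean_square unlock => /fine_cvgP[[N _ finN] cv].
have D2 : (fun w => X w - X_ N w) \in L2.
  apply: L2_of_sqr; first by apply: measurable_funB => //; exact: L2_measurable.
  by have /= := finN N (leqnn N); rewrite fin_numElt => /andP[].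
split.
  have -> : X = (fun w => (X w - X_ N w) + X_ N w) by apply/funext => w; rewrite subrK.
  exact: L2D.
apply: cvg_trans cv; apply: near_eq_cvg; apply: nearW => n.
by rewrite /= /inner /Rintegral; congr fine; apply: eq_integral => w _; rewrite expr2.
Qed.

End square_integrable.

(** * Moments of a standard Gaussian variable *)

Section standard_normal_moments.
Context {R : realType}.
Notation mu := (@lebesgue_measure R).
Notation pdf := (@normal_pdf R 0 1).
Implicit Types x : R.

Let pdfE x : pdf x = @normal_peak R 1 * expR (- (2^-1 * (x * x))).
Proof.
rewrite normal_pdfE ?oner_neq0// /normal_fun; congr (_ * expR _).
by rewrite subr0 expr1n; field.
Qed.

Let is_derive_pdf x : is_derive x 1 pdf (- x * pdf x).
Proof.
rewrite (funext pdfE) [X in is_derive _ _ _ X](_ : _ = @normal_peak R 1 *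
   (expR (- (2^-1 * (x * x))) * (- (2^-1 * (x * 1 + x * 1))))); last by field.
apply: is_derive1Z.
Qed.

Let continuous_pdf : continuous pdf.
Proof. by move=> x; exact: is_derive1_continuous (is_derive_pdf x). Qed.

Let pdf_even x : pdf (- x) = pdf x.
Proof. by rewrite !pdfE mulrNN. Qed.

Let pdf_ge0 x : 0 <= pdf x := normal_pdf_ge0 0 1 x.

Let measurable_pdf D : measurable_fun D pdf.
Proof. by apply: measurable_funTS; exact: measurable_normal_pdf. Qed.

(** The Radon-Nikodym derivative of the normal law agrees almost everywhere
    with the density, since both have the same integral on every measurable set. *)
Lemma ge0_integral_normal_prob (f : R -> R) : measurable_fun setT f ->
  (forall x, 0 <= f x) ->
  (\int[normal_prob 0 1]_x (f x)%:E = \int[mu]_x (f x * pdf x)%:E)%E.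
Proof.
move=> mf f0.
pose nu : {finite_measure set (measurableTypeR R) -> \bar R} := @normal_prob R 0 1.
have dom : nu `<< mu by exact: normal_prob_dominates.
have mf' : measurable_fun setT (fun x => (f x)%:E) by exact/measurable_EFinP.
have f0' x : (0 <= (f x)%:E)%E by rewrite lee_fin.
rewrite -(Radon_Nikodym_SigmaFinite.change_of_variables dom f0' measurableT mf').
have iRN := Radon_Nikodym_SigmaFinite.f_integrable dom.
apply: ae_eq_integral => //.
- by case/integrableP : iRN => mRN _; exact: emeasurable_funM.
- apply/measurable_EFinP; apply: measurable_funM; [exact: mf|exact: measurable_pdf].
- under [X in ae_eq _ _ _ X]eq_fun do rewrite EFinM.
  apply: ae_eqe_mul2l; apply: integral_ae_eq => //.
  + by apply/measurable_EFinP; exact: measurable_pdf.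
  + by move=> E _ mE; rewrite -Radon_Nikodym_SigmaFinite.f_integral.
Qed.

Let xpdf_cvg0 : n%:R * pdf n%:R @[n --> \oo] --> (0 : R).
Proof.
set c := @normal_peak R 1; have c0 : 0 <= c := normal_peak_ge0 1.
have cn : 2 * c * n.+1%:R^-1 @[n --> \oo] --> (0 : R).
  rewrite -[X in _ --> X](mulr0 (2 * c)).
  by apply: cvgM; [exact: cvg_cst|exact: cvg_harmonic].
rewrite -cvg_shiftS/=.
apply: (@squeeze_cvgr _ _ _ _ (cst 0) _ _ _ _ _ cn); last exact: cvg_cst.
apply: nearW => n; rewrite mulr_ge0//= pdfE mulrCA [leRHS]mulrAC [leRHS]mulrC ler_wpM2l//.
set m : R := n.+1%:R; have m0 : 0 < m by rewrite /m.
rewrite expRN ler_pdivrMr ?expR_gt0// mulrAC ler_pdivlMr//.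
have := expR_ge1Dx (2^-1 * (m * m)); have := sqr_ge0 m; rewrite expr2; lra.
Qed.

(** The function (x^2 - 1) pdf x has the primitive - x pdf x, which vanishes
    at 0 and at infinity: x^2 pdf x and pdf x have the same integral. *)
Lemma integral_sqr_normal_pdf : (\int[mu]_x (x ^+ 2 * pdf x)%:E = 1)%E.
Proof.
have symE (f : R -> R) : (forall x, 0 <= f x) -> continuous f ->
    (forall x, f (- x) = f x) ->
    (\int[mu]_x (f x)%:E = 2%:E * \int[mu]_(x in `[0%R, +oo[) (f x)%:E)%E.
  move=> f0 cf fe; rewrite ge0_symfun_integralT//; last by move=> x /=; rewrite fe.
  congr (_ * integral _ _ _)%E.
  by apply/seteqP; split => x/=; rewrite in_itv/= andbT.
have cx2 : continuous (fun x => x ^+ 2 * pdf x).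
  move=> x; apply: is_derive1_continuous.
  by apply: is_derive1M; exact: is_derive_pdf.
have p0 x : 0 <= x ^+ 2 * pdf x by rewrite mulr_ge0// sqr_ge0.
have mx2 : measurable_fun setT (fun x => x ^+ 2 * pdf x).
  exact: continuous_measurable_fun.
rewrite symE//; last by move=> x; rewrite sqrrN pdf_even.
rewrite -[RHS](@integral_normal_pdf R 0 1) symE//.
congr (_ * _)%E.
have h1 := @ge0_cvgn_integral R mu _ p0 mx2.
have h2 := @ge0_cvgn_integral R mu _ pdf_ge0 (@measurable_normal_pdf R 0 1).
have h3 : ((\int[mu]_(x in `[0%R, n%:R]) (x ^+ 2 * pdf x)%:E)%E + (n%:R * pdf n%:R)%:E)%E
    @[n --> \oo] --> (\int[mu]_(x in `[0%R, +oo[) (x ^+ 2 * pdf x)%:E + 0%:E)%E.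
  apply: cvgeD => //; first by rewrite fin_num_adde_defl.
  by apply: cvg_EFin; [exact: nearW|exact: xpdf_cvg0].
move: h3; rewrite adde0 => h3; apply: (cvg_unique _ h3) => //.
rewrite (_ : (fun n : nat => _) = (fun n => \int[mu]_(x in `[0%R, n%:R]) (pdf x)%:E)%E)//.
apply/funext => n.
case: n => [|n]; first by rewrite mul0r adde0 set_itv1 !integral_set1.
set m : R := n.+1%:R; have m0 : 0 < m by rewrite /m.
have int (f : R -> R) : continuous f -> mu.-integrable `[0, m] (EFin \o f).
  move=> cf; apply: continuous_compact_integrable; first exact: segment_compact.
  exact: continuous_subspaceT.
have dG x : is_derive x 1 (fun y => - y * pdf y) (x ^+ 2 * pdf x - pdf x).
  rewrite [X in is_derive _ _ _ X](_ : _ = - x * (- x * pdf x) + pdf x * -1); last by ring.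
  by apply: is_derive1M; exact: is_derive_pdf.
have cdG : continuous (fun x => x ^+ 2 * pdf x - pdf x).
  by move=> x; apply: cvgB; [exact: cx2|exact: continuous_pdf].
have : (\int[mu]_(x in `[0%R, m]) (x ^+ 2 * pdf x - pdf x)%:E)%E = (- m * pdf m)%:E.
  rewrite (@continuous_FTC2 _ _ (fun y => - y * pdf y) 0 m m0).
  - by rewrite oppr0 mul0r sube0.
  - exact: continuous_subspaceT.
  - split=> [x _| |]; first by have [] := dG x.
      by apply: cvg_at_right_filter; exact: is_derive1_continuous (dG _).
    by apply: cvg_at_left_filter; exact: is_derive1_continuous (dG _).
  - by move=> x _; rewrite derive1E; have [_ ->] := dG x.
under eq_integral do rewrite EFinB.
rewrite integralB//; [|exact: int..].
have fx2 : (\int[mu]_(x in `[0%R, m]) (x ^+ 2 * pdf x)%:E)%E \is a fin_num.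
  by apply: integrable_fin_num => //; exact: int.
have fx0 : (\int[mu]_(x in `[0%R, m]) (pdf x)%:E)%E \is a fin_num.
  by apply: integrable_fin_num => //; exact: int.
rewrite -(fineK fx2) -(fineK fx0) -EFinB => -[h].
by rewrite -EFinD; congr EFin; rewrite -[LHS]opprK opprD -mulNr -h; ring.
Qed.

(** The density is even. This form makes the mean of a Gaussian variable vanish,
    its integral being the difference of these two. *)
Lemma integral_normal_pdf_posneg :
  (\int[mu]_x (Num.max x 0 * pdf x)%:E = \int[mu]_x (Num.max (- x) 0 * pdf x)%:E)%E.
Proof.
have cxp : continuous (fun x => - x * pdf x).
  by move=> x; apply: is_derive1_continuous; apply: is_derive1M.
transitivity (\int[mu]_(x in `[0%R, +oo[) (x * pdf x)%:E)%E.
  rewrite [RHS]integral_mkcond; apply: eq_integral => x _.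
  rewrite patchE; case: ifPn; rewrite ?inE ?notin_setE /= in_itv/= andbT.
    by move=> x0; rewrite max_l.
  by move=> /negP; rewrite -ltNge => x0; rewrite max_r ?mul0r// ltW.
transitivity (\int[mu]_(x in `]-oo, (- 0)%R]) (- x * pdf x)%:E)%E.
  rewrite (@ge0_integration_by_substitutionNy _ (fun x => - x * pdf x)).
  - by apply: eq_integral => x _ /=; rewrite opprK pdf_even.
  - exact: continuous_subspaceT.
  - by move=> x; rewrite in_itv/= oppr0 => x0; rewrite mulr_ge0// oppr_ge0 ltW.
rewrite oppr0 [LHS]integral_mkcond; apply: eq_integral => x _.
rewrite patchE; case: ifPn; rewrite ?inE ?notin_setE /= in_itv/=.
  by move=> x0; rewrite max_l// oppr_ge0.
by move=> /negP; rewrite -ltNge => x0; rewrite max_r ?mul0r// oppr_le0 ltW.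
Qed.

End standard_normal_moments.

Section gaussian_variables.
Context d (Omega : measurableType d) (R : realType) (P : probability Omega R).
Notation mu := (@lebesgue_measure R).
Variable (Z : {RV P >-> R}).
Hypothesis Zg : standard_gaussian Z.

Lemma ge0_expectation_gaussian (f : R -> R) : measurable_fun setT f ->
  (forall x, 0 <= f x) ->
  (\int[P]_w (f (Z w))%:E = \int[mu]_x (f x * normal_pdf 0 1 x)%:E)%E.
Proof.
move=> mf f0; rewrite -ge0_integral_normal_prob//.
(* [Z'] is [Z] with values in the copy of the real line that carries the
   Lebesgue measure. *)
pose ZL : Omega -> measurableTypeR R := Z.
have mZ : measurable_fun setT Z by [].
have mZL : measurable_fun setT ZL by exact: mZ.
pose mixin := isMeasurableFun.Build _ _ _ _ _ mZL.
pose Z' : {RV P >-> measurableTypeR R} := HB.pack ZL mixin.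
have mf' : measurable_fun [set: measurableTypeR R] (EFin \o f) by exact/measurable_EFinP.
have := @ge0_integral_distribution _ _ _ (measurableTypeR R) _ P Z' (EFin \o f) mf'.
rewrite /comp/= => <-; last by move=> x; rewrite lee_fin.
apply: (@eq_measure_integral _ (measurableTypeR R) R setT
  (@normal_prob R 0 1) (distribution P Z') (EFin \o f)) => A mA _.
exact: Zg.
Qed.

Lemma gaussian_sqr : (\int[P]_w (Z w ^+ 2)%:E = 1)%E.
Proof.
rewrite (@ge0_expectation_gaussian (fun x => x ^+ 2)) ?integral_sqr_normal_pdf//.
by move=> x; exact: sqr_ge0.
Qed.

Lemma gaussian_L2 : (Z : Omega -> R) \in Lfun P 2%:E.
Proof. by apply: L2_of_sqr => //; rewrite gaussian_sqr ltry. Qed.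

Lemma gaussian_mean : (\int[P]_w (Z w)%:E = 0)%E.
Proof.
have fZ : (\int[P]_w (Z w)%:E)%E \is a fin_num.
  by apply: integrable_fin_num => //; exact/L2_integrable/gaussian_L2.
move: fZ; rewrite integralE.
have pos : (\int[P]_x ((fun w => (Z w)%:E)^\+ x) =
    \int[mu]_x (Num.max x 0 * normal_pdf 0 1 x)%:E)%E.
  rewrite -(@ge0_expectation_gaussian (fun x => Num.max x 0)).
  - by apply: eq_integral => w _; rewrite funeposE EFin_max.
  - exact: measurable_maxr.
  - by move=> x; rewrite le_max lexx orbT.
have neg : (\int[P]_x ((fun w => (Z w)%:E)^\- x) =
    \int[mu]_x (Num.max (- x) 0 * normal_pdf 0 1 x)%:E)%E.
  rewrite -(@ge0_expectation_gaussian (fun x => Num.max (- x) 0)).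
  - by apply: eq_integral => w _; rewrite funenegE -EFinN EFin_max.
  - by apply: measurable_maxr => //; exact: measurableT_comp.
  - by move=> x; rewrite le_max lexx orbT.
rewrite pos neg integral_normal_pdf_posneg fin_numD => /andP[fin _].
by rewrite subee.
Qed.

End gaussian_variables.

(** * Orthonormality of independent standard Gaussian variables *)

Section independence.
Context d (Omega : measurableType d) (R : realType) (P : probability Omega R).

(** By the product rule the joint law of X and Y is the product of their laws,
    and Fubini integrates Y first. *)
Lemma inner_independent_centered (X Y : {RV P >-> R}) :
  (X : Omega -> R) \in Lfun P 2%:E -> (Y : Omega -> R) \in Lfun P 2%:E ->
  (forall A B : set R, measurable A -> measurable B ->
     P (X @^-1` A `&` Y @^-1` B) = (P (X @^-1` A) * P (Y @^-1` B))%E) ->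
  (\int[P]_w (Y w)%:E = 0)%E -> inner P X Y = 0.
Proof.
move=> X2 Y2 XY Y0.
pose W w : R * R := (X w, Y w).
have mW : measurable_fun setT W by exact: measurable_fun_pair.
pose W' : {RV P >-> (R * R)%type} := HB.pack W (isMeasurableFun.Build _ _ _ _ _ mW).
pose m1 := distribution P X; pose m2 := distribution P Y.
have mprod : measurable_fun [set: R * R] (fun z => (z.1 * z.2)%:E).
  by apply/measurable_EFinP; exact: measurable_funM.
have joint A : measurable A -> (m1 \x m2)%E A = distribution P W' A.
  by move=> mA; apply: product_measure_unique => // A1 A2 mA1 mA2; rewrite -XY.
have iXY : P.-integrable setT ((fun z : R * R => (z.1 * z.2)%:E) \o W').
  exact: (L2_mul_integrable X2 Y2).
have iprod : (m1 \x m2)%E.-integrable setT (fun z => (z.1 * z.2)%:E).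
  apply/integrableP; split => //.
  rewrite (eq_measure_integral (distribution P W')); last by move=> A mA _; exact: joint.
  rewrite ge0_integral_distribution//; last exact: measurableT_comp.
  by case/integrableP : iXY.
have iY : m2.-integrable setT (EFin \o id).
  apply/integrableP; split; first exact/measurable_EFinP.
  rewrite ge0_integral_distribution//; last first.
    by apply: measurableT_comp => //; exact/measurable_EFinP.
  by case/integrableP : (L2_integrable Y2).
have mean2 : (\int[m2]_y y%:E = 0)%E.
  rewrite (@integral_distribution _ _ _ _ _ P Y (EFin \o id))//.
  - exact/measurable_EFinP.
  - exact: L2_integrable.
have fub := integral12_prod_meas1 iprod.
have : (\int[P]_w (X w * Y w)%:E = 0)%E.
  transitivity (\int[distribution P W']_z (z.1 * z.2)%:E)%E.
    by rewrite integral_distribution.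
  rewrite -(@eq_measure_integral _ _ _ setT (distribution P W') (m1 \x m2)%E); last first.
    by move=> A mA _; exact: joint.
  rewrite -fub integral0_eq// => x _; rewrite /fubini_F /=.
  under eq_integral do rewrite EFinM.
  by rewrite integralZl// mean2 mule0.
by rewrite (innerE X2 Y2) => -[].
Qed.

Lemma gaussian_orthonormal (Z : int -> {RV P >-> R}) :
  mutually_independent Z -> (forall k, standard_gaussian (Z k)) ->
  forall i j, inner P (Z i) (Z j) = (i == j)%:R.
Proof.
move=> indep gauss i j; have [<-|ij] := eqVneq i j.
  have Z2 := gaussian_L2 (gauss i).
  have := gaussian_sqr (gauss i).
  under eq_integral do rewrite expr2.
  by rewrite (innerE Z2 Z2) => -[].
apply: inner_independent_centered; [exact: gaussian_L2..| |exact: gaussian_mean].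
move=> A B mA mB.
(* Independence of the two-element subfamily. *)
pose C (k : int) := if k == i then A else B.
have := indep [:: i; j] C; rewrite /= inE ij => /(_ isT).
rewrite !big_cons big_nil mule1 /C eqxx eq_sym (negbTE ij).
move=> <-; last by move=> k; case: ifP.
congr (P _); apply/seteqP; split=> w /=.
  move=> [Aw Bw] k /=; rewrite !inE => /orP[/eqP->|/eqP->]; first by rewrite eqxx.
  by rewrite eq_sym (negbTE ij).
move=> h; split; first by have := h i; rewrite /= !inE !eqxx; exact.
by have := h j; rewrite /= !inE eqxx orbT eq_sym (negbTE ij); exact.
Qed.

End independence.

(** * Covariance of the partial sums *)

Section partial_sums.
Context d (Omega : measurableType d) (R : realType) (P : probability Omega R).
Variables (T H : R) (Z : int -> {RV P >-> R}).
Hypothesis orthoZ : forall i j, inner P (Z i) (Z j) = (i == j)%:R.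
Hypothesis ZL2 : forall i, (Z i : Omega -> R) \in Lfun P 2%:E.

Let S := series_partial_sum T H (fun k => Z k).
Let lam (k : nat) : R := T / (k%:R * pi) * Num.sqrt (- (cos_coef T H k / 2)).
Let si (t : R) (k : nat) : R := lam k * sin (k%:R * pi * t / T).
Let co (t : R) (k : nat) : R := lam k * (1 - cos (k%:R * pi * t / T)).

Let SS t n : S t n.+1 = fun w => S t n w +
  (si t n.+1 * Z n.+1%:Z w + co t n.+1 * Z (- n.+1%:Z) w).
Proof.
apply/funext => w; rewrite /S /series_partial_sum big_nat_recr//= addrA.
by rewrite /series_term /si /co /lam; congr (_ + _); ring.
Qed.

Let S0 t : S t 0 = fun w => Num.sqrt (H * T `^ (2 * H - 2)) * t * Z 0 w.
Proof. by apply/funext => w; rewrite /S /series_partial_sum big_geq// addr0. Qed.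

Let term_L2 (a b : R) (i j : int) :
  (fun w => a * Z i w + b * Z j w) \in Lfun P 2%:E.
Proof. by apply: L2D; exact: L2Z. Qed.

Lemma series_partial_sum_L2 t n : S t n \in Lfun P 2%:E.
Proof.
elim: n => [|n IH]; first by rewrite S0; exact: L2Z.
by rewrite SS; apply: L2D => //; exact: term_L2.
Qed.

Let inner_S_Z t n (j : int) : (n < `|j|)%N -> inner P (S t n) (Z j) = 0.
Proof.
elim: n => [|n IH] nj.
  rewrite S0 innerZl// orthoZ (_ : 0 == j = false) ?mulr0//.
  by apply/eqP => j0; rewrite -j0 in nj.
have neq (i : int) : `|i|%N = n.+1 -> (i == j) = false.
  by move=> in1; apply/eqP => ij; rewrite -ij in1 ltnn in nj.
rewrite SS innerDl ?series_partial_sum_L2// IH ?(ltnW nj)// add0r.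
rewrite innerDl ?L2Z// !innerZl// !orthoZ !neq// ?abszN//.
by rewrite !mulr0 addr0.
Qed.

Let inner_S s t n : 0 <= H * T `^ (2 * H - 2) ->
  inner P (S s n) (S t n) = H * T `^ (2 * H - 2) * s * t +
  \sum_(1 <= k < n.+1) (si s k * si t k + co s k * co t k).
Proof.
move=> H0; elim: n => [|n IH].
  rewrite !S0 innerZl ?L2Z// innerZr// orthoZ eqxx mulr1 big_geq// addr0.
  by rewrite -[in RHS](sqr_sqrtr H0); ring.
have Sn x := series_partial_sum_L2 x n.
have D2 x := term_L2 (si x n.+1) (co x n.+1) n.+1%:Z (- n.+1%:Z).
pose D x w := si x n.+1 * Z n.+1%:Z w + co x n.+1 * Z (- n.+1%:Z) w.
have SD x y : inner P (S x n) (D y) = 0.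
  by rewrite innerDr ?L2Z// !innerZr// !inner_S_Z ?abszN ?mulr0 ?addr0.
have DD x y : inner P (D x) (D y) = si x n.+1 * si y n.+1 + co x n.+1 * co y n.+1.
  have neq : (n.+1%:Z == - n.+1%:Z) = false by [].
  rewrite innerDl ?L2Z// ?D2// !innerDr ?L2Z// !innerZl ?L2Z// !innerZr// !orthoZ.
  by rewrite !eqxx neq eq_sym neq !mulr0 !mulr1 addr0 add0r.
rewrite !SS (innerDl (Sn s) (D2 s) (L2D (Sn t) (D2 t))).
rewrite (innerDr (Sn t) (D2 t) (Sn s)) (innerDr (Sn t) (D2 t) (D2 s)) IH.
rewrite -/(D s) -/(D t) SD (innerC P (D s)) SD DD [in RHS]big_nat_recr//=.
by rewrite addr0 add0r -addrA.
Qed.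

(** The contributions sin x sin y + (1 - cos x) (1 - cos y) of each frequency
    are equal to (1 - cos x) + (1 - cos y) - (1 - cos (y - x)). *)
Lemma inner_series_partial_sum s t n : 0 <= H * T `^ (2 * H - 2) ->
  inner P (S s n) (S t n) = H * T `^ (2 * H - 2) * s * t +
  (variance_sum T H n s + variance_sum T H n t - variance_sum T H n `|t - s|).
Proof.
move=> /inner_S ->; congr (_ + _).
rewrite /variance_sum -big_split/= -sumrB; apply: eq_bigr => k _.
rewrite /si /co -/(lam k); move: (lam k) => l.
have -> : cos (k%:R * pi * `|t - s| / T) = cos (k%:R * pi * t / T - k%:R * pi * s / T).
  by rewrite mulrAC cos_mul_dist; congr cos; ring.
by rewrite cosB; ring.
Qed.

End partial_sums.

Theorem theorem3p3 (R : realType) (d : measure_display)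
    (Omega : measurableType d) (P : probability Omega R)
    (T H : R) (hT : 0 < T) (hH : 1 / 2 < H < 1)
    (Z : int -> {RV P >-> R})
    (hZindep : mutually_independent Z)
    (hZgauss : forall k : int, standard_gaussian (Z k))
    (B : R -> {RV P >-> R})
    (hB : forall t : R, 0 <= t <= T ->
      cvg_mean_square P (series_partial_sum T H (fun k => Z k) t) (B t)) :
  forall s t : R, 0 <= s <= T -> 0 <= t <= T ->
    'E_P[(fun w => B s w * B t w)%R]%E =
    (1 / 2 * (t `^ (2 * H) + s `^ (2 * H) - `|t - s| `^ (2 * H)))%:E.
Proof.
move=> s t hs ht.
have ortho := gaussian_orthonormal hZindep hZgauss.
have Z2 i := gaussian_L2 (hZgauss i).
have S2 x n := series_partial_sum_L2 T H Z2 x n.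
have mB x : measurable_fun setT (B x) by [].
have [Bs2 cvs] := cvg_mean_square_inner (mB s) (S2 s) (hB s hs).
have [Bt2 cvt] := cvg_mean_square_inner (mB t) (S2 t) (hB t ht).
rewrite unlock (innerE Bs2 Bt2); congr EFin.
have H0 : 0 <= H * T `^ (2 * H - 2).
  by rewrite mulr_ge0 ?powR_ge0//; move/andP: hH => [? _]; lra.
have lim := cvg_inner Bs2 Bt2 (S2 s) (S2 t) cvs cvt.
have hst : 0 <= `|t - s| <= T.
  move/andP: hs => [? ?]; move/andP: ht => [? ?].
  by rewrite normr_ge0/= ler_norml; apply/andP; split; lra.
have V u (hu : 0 <= u <= T) := cvg_variance_series hT hH hu.
apply: (cvg_unique _ lim) => //.
have -> : (fun n => inner P (series_partial_sum T H (fun k => Z k) s n)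
     (series_partial_sum T H (fun k => Z k) t n)) =
   (fun n => H * T `^ (2 * H - 2) * s * t +
  (variance_sum T H n s + variance_sum T H n t - variance_sum T H n `|t - s|)).
  by apply/funext => n; exact: inner_series_partial_sum.
have -> : 1 / 2 * (t `^ (2 * H) + s `^ (2 * H) - `|t - s| `^ (2 * H)) =
   H * T `^ (2 * H - 2) * s * t +
   ((s `^ (2 * H) - H * T `^ (2 * H - 2) * s ^+ 2) / 2 +
    (t `^ (2 * H) - H * T `^ (2 * H - 2) * t ^+ 2) / 2 -
    (`|t - s| `^ (2 * H) - H * T `^ (2 * H - 2) * `|t - s| ^+ 2) / 2).
  by rewrite real_normK ?num_real//; field.
apply: cvgD; first exact: cvg_cst.
by apply: cvgB; [apply: cvgD|]; exact: V.
Qed.
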